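(* Let $C: a_1x_1+\dots+a_nx_n\le K$ be a Pseudo-Boolean constraint with positive integer coefficients and positive integer $K$, and let $m$ be the size (number of nodes) of its ROBDD with respect to the ordering $[x_1,\dots,x_n]$. The algorithm $\mathbf{Main}$ described in the context, run on $C$, takes $\mathcal{O}(nm\log m)$ time and is correct in the following sense: 1. For every call $\mathbf{BDDConstruction}(i,\ a_ix_i+\dots+a_nx_n\le K',\ \mathcal{L})$ made during the execution, $K'$ belongs to the interval returned by that call. 2. The pair $([\beta,\gamma],\mathcal{B})$ returned by such a call consists of a BDD $\mathcal{B}$ and its interval $[\beta,\gamma]$, i.e. $[\beta,\gamma]$ is the set of all integers $M$ such that $\mathcal{B}$ represents the Boolean function $a_ix_i+\dots+a_nx_n\le M$. 3. If such a call returns $([\beta,\gamma],\mathcal{B})$, then the BDD $\mathcal{B}$ is reduced.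
   Context: A Pseudo-Boolean constraint over Boolean ($0/1$) variables is viewed as the Boolean function with value 1 exactly on the assignments satisfying the inequality. An ordered BDD is reduced (ROBDD) if no node has two identical children and no two distinct nodes root isomorphic subdiagrams; for a fixed ordering each Boolean function has a unique ROBDD. All intervals are sets of integers. Arithmetic operations on integers are counted as unit cost. Data: a shared, mutable tuple $\mathcal{L}=(L_1,\dots,L_{n+1})$, where each $L_i$ is a set of pairs $([\beta,\gamma],\mathcal{B})$ of an interval and a BDD, stored in a balanced search tree so that the following take time logarithmic in $|L_i|$: $\mathbf{search}(K',L_i)$ returns a pair $([\beta,\gamma],\mathcal{B})\in L_i$ with $K'\in[\beta,\gamma]$ if one exists and otherwise a pair whose first component is the empty interval; $\mathbf{insert}$ adds a pair to $L_i$. $\mathbf{Main}$ on $a_1x_1+\dots+a_nx_n\le K$: for each $1\le i\le n+1$ set $L_i\leftarrow\{((-\infty,-1],\mathrm{False}),\ ([a_i+a_{i+1}+\dots+a_n,\infty),\mathrm{True})\}$ (the empty sum being $0$ for $i=n+1$); call $\mathbf{BDDConstruction}(1,\ a_1x_1+\dots+a_nx_n\le K,\ \mathcal{L})$ and return the BDD component of the result. $\mathbf{BDDConstruction}(i,\ a_ix_i+\dots+a_nx_n\le K',\ \mathcal{L})$: let $([\beta,\gamma],\mathcal{B})\leftarrow\mathbf{search}(K',L_i)$. If $[\beta,\gamma]\ne\emptyset$, return $([\beta,\gamma],\mathcal{B})$. Otherwise: (a) $([\beta_F,\gamma_F],\mathcal{B}_F)\leftarrow\mathbf{BDDConstruction}(i+1,\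 a_{i+1}x_{i+1}+\dots+a_nx_n\le K',\ \mathcal{L})$; (b) $([\beta_T,\gamma_T],\mathcal{B}_T)\leftarrow\mathbf{BDDConstruction}(i+1,\ a_{i+1}x_{i+1}+\dots+a_nx_n\le K'-a_i,\ \mathcal{L})$; (c) if $[\beta_T,\gamma_T]=[\beta_F,\gamma_F]$, set $\mathcal{B}\leftarrow\mathcal{B}_T$ and $[\beta,\gamma]\leftarrow[\beta_T+a_i,\gamma_T]$; otherwise set $\mathcal{B}$ to the BDD whose root has selector variable $x_i$, true branch $\mathcal{B}_T$ and false branch $\mathcal{B}_F$, and $[\beta,\gamma]\leftarrow[\beta_F,\gamma_F]\cap[\beta_T+a_i,\gamma_T+a_i]$; (d) insert $([\beta,\gamma],\mathcal{B})$ into $L_i$ and return $([\beta,\gamma],\mathcal{B})$. The $\mathcal{O}$-bound is understood for $m\ge2$. *)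

(* Defs.v *)
From mathcomp Require Import all_boot all_order all_algebra.
From Stdlib Require List.

Set Implicit Arguments.
Unset Strict Implicit.
Unset Printing Implicit Defensive.

Import Order.TTheory GRing.Theory Num.Theory.
Local Open Scope ring_scope.

(* Everything is 0-based: the variable x_(j+1), its
   coefficient a_(j+1) and the list L_(j+1) have index j. *)

(** * Binary decision diagrams *)

(* A BDD is a root address in a graph of nodes with explicit sharing: nodes have
   an identity (their address), so that two distinct nodes may well root
   isomorphic subdiagrams.  [Branch i t f] has selector variable [i], true
   branch [t] and false branch [f]. *)
Inductive node := Leaf of bool | Branch of nat & nat & nat.

Definition graph := seq node.

Definition assignment := nat -> bool.

Inductive reach (g : graph) (r : nat) : nat -> Prop :=
| reach_root : reach g r r
| reach_true p i t f :
    reach g r p -> onth g p = Some (Branch i t f) -> reach g r t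
| reach_false p i t f :
    reach g r p -> onth g p = Some (Branch i t f) -> reach g r f.

Inductive evals (g : graph) (x : assignment) : nat -> bool -> Prop :=
| evals_leaf p b : onth g p = Some (Leaf b) -> evals g x p b
| evals_branch p i t f b :
    onth g p = Some (Branch i t f) ->
    evals g x (if x i then t else f) b -> evals g x p b.

Definition represents (g : graph) (r : nat) (F : assignment -> bool) : Prop :=
  forall x, evals g x r (F x).

(* A well-formed diagram over the first [n] variables, tested in increasing
   order along every path; in particular it has no dangling edge and no cycle. *)
Definition ordered_bdd (n : nat) (g : graph) (r : nat) : Prop :=
  (forall p, reach g r p -> (p < size g)%N) /\
  (forall p i t f, reach g r p -> onth g p = Some (Branch i t f) ->
     (i < n)%N /\
     (forall c j t' f', c = t \/ c = f ->
        onth g c = Some (Branch j t' f') -> (i < j)%N)).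

Definition map_node (s : nat -> nat) (nd : node) : node :=
  match nd with
  | Leaf b => Leaf b
  | Branch i t f => Branch i (s t) (s f)
  end.

(* [s] is a bijection from the nodes below [u] onto the nodes below [v] that
   preserves the root, the labels and both kinds of edges. *)
Definition isomorphic_at (g : graph) (u v : nat) : Prop :=
  exists s : nat -> nat,
    [/\ s u = v,
        forall p q, reach g u p -> reach g u q -> s p = s q -> p = q,
        forall q, reach g v q <-> exists2 p, reach g u p & s p = q
      & forall p nd, reach g u p -> onth g p = Some nd ->
          onth g (s p) = Some (map_node s nd)].

Definition reduced (g : graph) (r : nat) : Prop :=
  (forall p i t f, reach g r p -> onth g p = Some (Branch i t f) -> t <> f) /\
  (forall u v, reach g r u -> reach g r v -> u <> v -> ~ isomorphic_at g u v).

Definition ROBDD (n : nat) (g : graph) (r : nat) : Prop :=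
  ordered_bdd n g r /\ reduced g r.

(* Terminal nodes are counted. *)
Definition bdd_size (g : graph) (r m : nat) : Prop :=
  exists s : seq nat,
    [/\ uniq s, size s = m & forall p, p \in s <-> reach g r p].

(** * Pseudo-Boolean constraints *)

(* The function  a_i x_i + ... + a_(n-1) x_(n-1) <= M,  with n = size a. *)
Definition pb (a : seq int) (i : nat) (M : int) : assignment -> bool :=
  fun x => \sum_(i <= j < size a) a`_j * (x j)%:R <= M.

(* m is the number of nodes of the ROBDD of  a_0 x_0 + ... <= K  for the
   ordering [x_0, ..., x_(n-1)]. *)
Definition robdd_size (a : seq int) (K : int) (m : nat) : Prop :=
  exists g r,
    [/\ ROBDD (size a) g r, represents g r (pb a 0 K) & bdd_size g r m].

(** * Intervals of integers *)

(* Only the forms [b, c], (-oo, c], [b, +oo), (-oo, +oo) occur. *)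
Definition shift_bound (d : int) (b : itv_bound int) : itv_bound int :=
  match b with
  | BSide s z => BSide s (z + d)
  | BInfty s => BInfty _ s
  end.

Definition lower (I : interval int) := let: Interval l _ := I in l.
Definition upper (I : interval int) := let: Interval _ u := I in u.

(* On these closed forms this decides [I =i J], the equality as sets: distinct
   representations denote the same set only if both are empty. *)
Definition same_itv (I J : interval int) : bool :=
  (I == J) || ((upper I <= lower I)%O && (upper J <= lower J)%O).

(** * Search trees *)

Definition entry := (interval int * nat)%type.

(* An arbitrary implementation of the sets L_i in which both operations take
   logarithmic time; the successor makes the bound meaningful for sets with at
   most one element.  [search] returns [None] where the pseudo-code returns a
   pair with an empty interval. *)
Record search_tree := SearchTree {
  tree : Type;
  elems : tree -> seq entry;
  empty : tree;
  search : int -> tree -> option entry;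
  insert : entry -> tree -> tree;
  search_time : int -> tree -> nat;
  insert_time : entry -> tree -> nat;
  log_factor : nat;
  elems_uniq : forall t, uniq (elems t);
  elems_empty : elems empty = [::];
  elems_insert : forall e t, elems (insert e t) =i e :: elems t;
  searchP : forall k t,
    match search k t with
    | Some e => e \in elems t /\ k \in e.1
    | None => forall e, e \in elems t -> k \notin e.1
    end;
  search_time_log : forall k t,
    (search_time k t <= log_factor * (trunc_log 2 (size (elems t))).+1)%N;
  insert_time_log : forall e t,
    (insert_time e t <= log_factor * (trunc_log 2 (size (elems t))).+1)%N
}.

(** * The algorithm *)

(* A completed call: its arguments, the pair returned, and the memory at the
   moment of the return, in which the returned address is to be read. *)
Record call := Call {
  call_index : nat;
  call_bound : int;
  call_itv : interval int;
  call_root : nat;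
  call_graph : graph
}.

Record state (S : search_tree) := State {
  memory : graph;
  lists : nat -> tree S;
  calls : seq call;
  time : nat
}.

Section Algorithm.

Variable S : search_tree.

(* The time charged for the constant-time part of one phase of a call. *)
Variable c0 : nat.

Definition spend (d : nat) (st : state S) : state S :=
  State (memory st) (lists st) (calls st) (time st + d).

Definition return_from (i : nat) (K' : int) (e : entry) (st : state S) :
    option (entry * state S) :=
  Some (e, State (memory st) (lists st)
             (rcons (calls st) (Call i K' e.1 e.2 (memory st))) (time st)).

(* A new node is always allocated: there is no table of existing nodes. *)
Definition new_node (nd : node) (st : state S) : nat * state S :=
  (size (memory st),
   State (rcons (memory st) nd) (lists st) (calls st) (time st)).

Definition insert_at (i : nat) (e : entry) (st : state S) : state S :=
  State (memory st)
    (fun j => if j == i then insert e (lists st i) else lists st j)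
    (calls st) (time st + insert_time e (lists st i)).

(* [s] is the list a_i, ..., a_(n-1) of coefficients of the constraint.  [None]
   is a run-time error: a miss in the last list, where no variable is left. *)
Fixpoint BDDConstruction (i : nat) (s : seq int) (K' : int) (st : state S) :
    option (entry * state S) :=
  let st0 := spend (c0 + search_time K' (lists st i)) st in
  match search K' (lists st i) with
  | Some e => return_from i K' e st0
  | None =>
    match s with
    | [::] => None
    | ai :: s' =>
      match BDDConstruction i.+1 s' K' st0 with
      | None => None
      | Some (IF, BF, st1) =>
        match BDDConstruction i.+1 s' (K' - ai) st1 with
        | None => None
        | Some (IT, BT, st2) =>
          let: (e, st3) :=
            if same_itv IT IF then
              ((Interval (shift_bound ai (lower IT)) (upper IT), BT), st2)
            else
              let: (B, st') := new_node (Branch i BT BF) st2 in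
              let IT' := Interval (shift_bound ai (lower IT))
                                  (shift_bound ai (upper IT)) in
              (((IF `&` IT')%O, B), st') in
          return_from i K' e (insert_at i e (spend c0 st3))
        end
      end
    end
  end.

(* The terminals have addresses 0 and 1 and are shared by all the lists. *)
Definition terminals : graph := [:: Leaf false; Leaf true].
Definition false_entry : entry := (`]-oo, (-1)%R], 0%N).
Definition true_entry (a : seq int) (i : nat) : entry :=
  (`[\sum_(i <= j < size a) a`_j, +oo[, 1%N).

Definition initial_list (a : seq int) (i : nat) : tree S :=
  insert (true_entry a i) (insert false_entry (empty S)).

(* The sums a_i + ... + a_(n-1) are accumulated from i = n downwards, hence the
   constant charge [c0] for each of them. *)
Definition initial_time (a : seq int) : nat :=
  (\sum_(i < (size a).+1)
     (c0 + insert_time false_entry (empty S)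
         + insert_time (true_entry a i) (insert false_entry (empty S))))%N.

Definition Main (a : seq int) (K : int) : option (nat * state S) :=
  let st := State terminals (initial_list a) [::] (initial_time a) in
  match BDDConstruction 0 a K st with
  | Some (_, B, st') => Some (B, st')
  | None => None
  end.

End Algorithm.

(* Main.v *)
Require Import Defs.
From mathcomp Require Import all_boot all_order all_algebra.
From mathcomp Require Import zify.
From Stdlib Require List.

Import Order.TTheory GRing.Theory Num.Theory.
Local Open Scope ring_scope.

Set Implicit Arguments.
Unset Strict Implicit.
Unset Printing Implicit Defensive.

(* All diagrams built by the algorithm live in one memory in which distinct
   addresses represent distinct functions.  This is preserved because a new
   node for x_i is only allocated after a miss in L_i: it depends on x_i, so an
   older node with the same function would also test x_i, hence would be the
   root of an entry of L_i, whose interval would have contained the bound.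
   Reducedness follows, and the interval of an entry is the exact set of bounds
   of its function because the two branches of a function of x_i, x_(i+1), ...
   determine it and conversely.  Every entry of L_i that is not initial contains
   a cofactor of the constraint, and distinct entries contain distinct
   cofactors; each cofactor is a node of the ROBDD, so L_i has at most m + 2
   entries and at most n m calls miss. *)

(** * Semantics of ordered diagrams: evaluation, dependence on variables, cofactors *)

Section Diagrams.

Implicit Types (g : graph) (x y : assignment) (p q r : nat) (b : bool).

Definition same_function g p q := forall x b, evals g x p b <-> evals g x q b.

Definition tests_from g k p :=
  forall j t f, onth g p = Some (Branch j t f) -> (k <= j)%N.

Definition update x i b : assignment := fun j => if j == i then b else x j.

Lemma evals_branchE g x p i t f b :
  onth g p = Some (Branch i t f) ->
  evals g x p b <-> evals g x (if x i then t else f) b.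
Proof.
move=> gp; split=> [ev|]; last exact: evals_branch gp.
by case: ev gp => [q c ->|q j t' f' c -> ev [<- <- <-]].
Qed.

Lemma evals_leafE g x p c b :
  onth g p = Some (Leaf c) -> evals g x p b <-> b = c.
Proof.
move=> gp; split=> [ev|->]; last exact: evals_leaf.
by case: ev gp => [q d -> [->]|q j t f d ->].
Qed.

Lemma evals_det g x p b c : evals g x p b -> evals g x p c -> b = c.
Proof.
move=> ev; elim: ev c => {p b} [p b gp c /(evals_leafE _ _ gp)->//|].
by move=> p i t f b gp _ IH c /(evals_branchE _ _ gp)/IH.
Qed.

Lemma represents_same g p q F :
  represents g p F -> represents g q F -> same_function g p q.
Proof.
move=> pF qF x b; split=> ev.
  by rewrite (evals_det ev (pF x)).
by rewrite (evals_det ev (qF x)).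
Qed.

Lemma represents_eq g p F G : F =1 G -> represents g p F -> represents g p G.
Proof. by move=> FG pF x; rewrite -FG. Qed.

Lemma represents_inj g p F G : represents g p F -> represents g p G -> F =1 G.
Proof. by move=> pF pG x; apply: evals_det (pF x) (pG x). Qed.

Lemma reach_trans g p q r : reach g p q -> reach g q r -> reach g p r.
Proof.
move=> pq; elim=> // {}r i t f _ pr gr.
  exact: reach_true pr gr.
exact: reach_false pr gr.
Qed.

Lemma ordered_bdd_reach n g p q :
  ordered_bdd n g p -> reach g p q -> ordered_bdd n g q.
Proof.
move=> [in_g ord] pq; split=> [r qr|r i t f qr].
  exact/in_g/(reach_trans pq).
exact/ord/(reach_trans pq).
Qed.

Lemma reach_child g x p i t f :
  onth g p = Some (Branch i t f) -> reach g p (if x i then t else f).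
Proof.
move=> gp; case: (x i).
  exact: reach_true (reach_root g p) gp.
exact: reach_false (reach_root g p) gp.
Qed.

Lemma tests_from_child n g x p i t f :
  ordered_bdd n g p -> onth g p = Some (Branch i t f) ->
  tests_from g i.+1 (if x i then t else f).
Proof.
move=> [_ ord] gp j t' f'.
have [_ /(_ (if x i then t else f) j t' f')] := ord _ _ _ _ (reach_root g p) gp.
by apply; case: (x i); [left|right].
Qed.

Lemma tests_fromW g k l p : (k <= l)%N -> tests_from g l p -> tests_from g k p.
Proof. by move=> kl lp j t f /lp; apply: leq_trans. Qed.

(** Along any path the tested variables increase, so an evaluation that starts at a node testing
    only indices from [k] on never reads [x] below [k]. The induction is on the evaluation, with [k]
    moving to the successor of the index just tested. *)
Lemma evals_agree n g k p x y b :
  ordered_bdd n g p -> tests_from g k p ->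
  (forall j, (k <= j)%N -> x j = y j) -> evals g x p b -> evals g y p b.
Proof.
move=> + + + ev; elim: ev k => {p b} [p b gp k _ _ _|]; first exact: evals_leaf.
move=> p i t f b gp _ IH k ord from_k agree.
apply/(evals_branchE _ _ gp); have ki := from_k _ _ _ gp.
rewrite -agree //; apply: (IH i.+1).
- exact: ordered_bdd_reach ord (reach_child x gp).
- exact: tests_from_child ord gp.
- by move=> j ij; apply: agree; apply: leq_trans ki (ltnW ij).
Qed.

Lemma evals_update n g i p x c b :
  ordered_bdd n g p -> tests_from g i.+1 p ->
  evals g (update x i c) p b <-> evals g x p b.
Proof.
move=> ord from_i; have agree j : (i < j)%N -> update x i c j = x j.
  by move=> ij; rewrite /update gtn_eqF.
split; apply: evals_agree ord from_i _ => // j /agree //.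
Qed.

(** Since [q] does not read variable [i], forcing that variable to either value makes each child of
    [p] compute the function of [q]; hence both children agree. *)
Lemma same_function_children n g p q i t f :
  ordered_bdd n g p -> ordered_bdd n g q -> tests_from g i.+1 q ->
  onth g p = Some (Branch i t f) -> same_function g p q -> same_function g t f.
Proof.
move=> ordp ordq from_i gp pq x b.
have child c : evals g x (if c then t else f) b <-> evals g x q b.
  have xi : update x i c i = c by rewrite /update eqxx.
  have := pq (update x i c) b.
  have := evals_branchE (update x i c) b gp; rewrite xi.
  have := evals_update x c b ordq from_i.
  suff : evals g (update x i c) (if c then t else f) b <->
         evals g x (if c then t else f) b by tauto.
  (* Only the two branch selectors [c] are rewritten into [update x i c i], so that the facts on the
     child chosen by an assignment apply. *)
  rewrite -{2 3}xi; apply: (@evals_update n).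
    exact: ordered_bdd_reach ordp (reach_child _ gp).
  exact: tests_from_child ordp gp.
by have := child true; have := child false => /=; tauto.
Qed.

Lemma isomorphic_evals g u v :
  isomorphic_at g u v -> forall x b, evals g x u b -> evals g x v b.
Proof.
move=> [s [<- _ _ lab]] x b ev.
have: forall p, reach g u p -> evals g x p b -> evals g x (s p) b.
  move=> p up evp; elim: evp up => {p b ev} [p b gp up|p i t f b gp _ IH up].
    exact: evals_leaf (lab _ _ up gp).
  apply: (evals_branch (lab _ _ up gp)).
  have := IH (reach_trans up (reach_child x gp)).
  by case: (x i).
by apply=> //; apply: reach_root.
Qed.

(** Descend from the root along [y]: if the current node tests exactly the variable being fixed,
    follow the edge given by [y]; otherwise the node does not depend on it and stays. The first
    hypothesis stands in for functional extensionality on assignments. *)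
Lemma cofactor_node n g r (F : assignment -> bool) y i :
  (forall x x', x =1 x' -> F x = F x') ->
  ordered_bdd n g r -> represents g r F ->
  exists p, [/\ reach g r p, tests_from g i p &
    represents g p (fun x => F (fun j => if (j < i)%N then y j else x j))].
Proof.
move=> Fext ord rF; elim: i => [|i [p [rp from_i pF]]].
  by exists r; split=> //; apply: reach_root.
have ordp := ordered_bdd_reach ord rp.
have cof x : evals g (update x i (y i)) p
    (F (fun j => if (j < i.+1)%N then y j else x j)).
  rewrite -(Fext (fun j => if (j < i)%N then y j else update x i (y i) j)) //.
  move=> j; rewrite /update ltnS (leq_eqVlt j i).
  by case: eqP => [->|_] /=; rewrite ?ltnn.
case gp: (onth g p) => [[b|j t f]|].
- exists p; split=> //; first by move=> j t f; rewrite gp.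
  by move=> x; apply/(evals_leafE _ _ gp)/(evals_leafE _ _ gp)/cof.
- have ij := from_i _ _ _ gp; move: ij; rewrite leq_eqVlt => /orP[/eqP ij|ij].
    subst j; exists (if y i then t else f).
    have rc := reach_child y gp; have fc := tests_from_child (x := y) ordp gp.
    split=> //; first exact: reach_trans rp rc.
    move=> x; have /(evals_branchE _ _ gp) := cof x.
    rewrite {2}/update eqxx.
    by move/(evals_update _ _ _ (ordered_bdd_reach ordp rc) fc).
  have from_i1 : tests_from g i.+1 p by move=> k t' f'; rewrite gp => -[<-].
  exists p; split=> // x.
  exact/(evals_update _ _ _ ordp from_i1)/cof.
(* A dangling address is impossible, because [p] evaluates to something. *)
- by case: (cof y) gp => [q b ->|q j t f b ->].
Qed.

End Diagrams.

(** * Memories reduced as a whole, and their extension by one node *)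

Section Memory.

Implicit Types (g : graph) (x : assignment) (p q r : nat) (b : bool).

(* A memory shared by several diagrams over [n] variables, reduced as a whole. *)
Record shared_memory n g : Prop := SharedMemory {
  memory_leaf p b : onth g p = Some (Leaf b) <-> p = b;
  memory_branch p i t f : onth g p = Some (Branch i t f) ->
    [/\ (i < n)%N, (t < p)%N, (f < p)%N & t <> f] /\
    tests_from g i.+1 t /\ tests_from g i.+1 f;
  memory_inj p q :
    (p < size g)%N -> (q < size g)%N -> same_function g p q -> p = q
}.

Lemma onth_size g p nd : onth g p = Some nd -> (p < size g)%N.
Proof. by move=> gp; rewrite ltnNge; apply/negP => /onth_default; rewrite gp. Qed.

Lemma onth_Some g p : (p < size g)%N -> exists nd, onth g p = Some nd.
Proof.
by rewrite -onthTE; case: (onth g p) => // nd _; exists nd.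
Qed.

Variables (n : nat) (g : graph).
Hypothesis gP : shared_memory n g.

Lemma memory_reach p q : (p < size g)%N -> reach g p q -> (q < size g)%N.
Proof.
move=> pg; elim=> // {}q i t f _ qg /(memory_branch gP)[[_ tq fq _] _].
  exact: ltn_trans qg.
exact: ltn_trans qg.
Qed.

Lemma memory_ordered p : (p < size g)%N -> ordered_bdd n g p.
Proof.
move=> pg; split=> [q|q i t f _ gq]; first exact: memory_reach.
have [[? _ _ _] [ti fi]] := memory_branch gP gq.
by split=> // c j t' f' [->|->]; [apply: ti|apply: fi].
Qed.

Lemma evals_total x p : (p < size g)%N -> exists b, evals g x p b.
Proof.
elim/ltn_ind: p => p IH pg; have [[b|i t f] gp] := onth_Some pg.
  by exists b; apply: evals_leaf.
have [[_ tp fp _] _] := memory_branch gP gp.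
have cp : ((if x i then t else f) < p)%N by case: ifP.
have [b ev] := IH _ cp (ltn_trans cp pg).
by exists b; apply: evals_branch gp ev.
Qed.

(** Isomorphic subdiagrams compute the same function, and the memory holds each function at one
    address only. *)
Lemma memory_ROBDD r : (r < size g)%N -> ROBDD n g r.
Proof.
move=> rg; split; first exact: memory_ordered.
split=> [p i t f _ /(memory_branch gP)[[]]//|u v ru rv uv iso].
apply: uv; apply: (memory_inj gP); try exact: memory_reach rg _.
move=> x b; split; first exact: isomorphic_evals.
(* An isomorphism transports evaluations in one direction only; the converse follows because
   evaluation is total and deterministic. *)
move=> ev; have [c evu] := evals_total x (memory_reach rg ru).
by rewrite (evals_det ev (isomorphic_evals iso evu)).
Qed.

Lemma onth_rcons_lt nd p : (p < size g)%N -> onth (rcons g nd) p = onth g p.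
Proof. by move=> pg; rewrite -cats1 onth_cat pg. Qed.

Lemma onth_rcons_size nd : onth (rcons g nd) (size g) = Some nd.
Proof. by rewrite -cats1 onth_cat ltnn subnn. Qed.

Lemma onth_rcons_inv nd p nd' : onth (rcons g nd) p = Some nd' ->
  ((p < size g)%N /\ onth g p = Some nd') \/ p = size g /\ nd' = nd.
Proof.
move=> gp; have := onth_size gp; rewrite size_rcons ltnS leq_eqVlt.
case/orP=> [/eqP ep|pg].
  by right; move: gp; rewrite ep onth_rcons_size => -[].
by left; split=> //; rewrite -gp onth_rcons_lt.
Qed.

Lemma evals_rcons nd x p b : (p < size g)%N ->
  evals (rcons g nd) x p b <-> evals g x p b.
Proof.
move=> pg; have up q c : evals g x q c -> evals (rcons g nd) x q c.
  elim=> {q c} [q c gq|q i t f c gq _].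
    by apply: evals_leaf; rewrite onth_rcons_lt ?(onth_size gq).
  by apply: evals_branch; rewrite onth_rcons_lt ?(onth_size gq).
split=> [ev|/up//]; have [c evg] := evals_total x pg.
by rewrite (evals_det ev (up _ _ evg)).
Qed.

Lemma represents_rcons nd p F : (p < size g)%N ->
  represents (rcons g nd) p F <-> represents g p F.
Proof. by move=> pg; split=> pF x; apply/(evals_rcons _ _ _ pg). Qed.

Lemma tests_from_rcons nd k p : (p < size g)%N ->
  tests_from (rcons g nd) k p <-> tests_from g k p.
Proof. by move=> pg; rewrite /tests_from onth_rcons_lt. Qed.

(** Edges out of old nodes lead to smaller, hence old, addresses, so the appended node is never
    reached; nothing has to be assumed about [nd]. *)
Lemma ordered_bdd_rcons nd p :
  (p < size g)%N -> ordered_bdd n (rcons g nd) p.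
Proof.
move=> pg; have old q : reach (rcons g nd) p q -> (q < size g)%N.
  elim=> // {}q i t f _ qg; rewrite onth_rcons_lt // => gq.
    by apply: memory_reach qg _; apply: reach_true (reach_root g q) gq.
  by apply: memory_reach qg _; apply: reach_false (reach_root g q) gq.
split=> [q /old qg|q i t f /old qg]; first by rewrite size_rcons ltnW.
rewrite onth_rcons_lt // => gq.
have [[? tq fq _] [ti fi]] := memory_branch gP gq.
split=> // c j t' f' [->|->]; rewrite onth_rcons_lt //.
- exact: ti.
- exact: ltn_trans tq qg.
- exact: fi.
- exact: ltn_trans fq qg.
Qed.

(* No old address computes the function of the new node: one that tests no
   variable up to [i] would make [t] and [f] agree, and for one that tests an
   earlier variable its own two children would agree. *)
Lemma shared_memory_rcons i t f :
  (i < n)%N -> (t < size g)%N -> (f < size g)%N -> t <> f ->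
  tests_from g i.+1 t -> tests_from g i.+1 f ->
  (forall p t' f', onth g p = Some (Branch i t' f') ->
     ~ same_function (rcons g (Branch i t f)) p (size g)) ->
  shared_memory n (rcons g (Branch i t f)).
Proof.
move=> i_n tg fg tf ti fi fresh; set g' := rcons g _.
have gs : onth g' (size g) = Some (Branch i t f) by apply: onth_rcons_size.
have same_old p q : (p < size g)%N -> (q < size g)%N ->
    same_function g' p q -> p = q.
  move=> pg qg pq; apply: (memory_inj gP) => // x b.
  have := pq x b; have := evals_rcons (Branch i t f) x b pg.
  by have := evals_rcons (Branch i t f) x b qg; tauto.
have leaf p b : onth g' p = Some (Leaf b) <-> p = b.
  split=> [/onth_rcons_inv[[_ /(memory_leaf gP)]//|[_ //]]|].
  move/(memory_leaf gP) => gp; rewrite onth_rcons_lt //; exact: onth_size gp.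
have branch p j u v : onth g' p = Some (Branch j u v) ->
    [/\ (j < n)%N, (u < p)%N, (v < p)%N & u <> v] /\
    tests_from g' j.+1 u /\ tests_from g' j.+1 v.
  case/onth_rcons_inv=> [[pg gp]|[-> [-> -> ->]]].
    have [[jn up vp uv] [ju jv]] := memory_branch gP gp.
    split=> //; rewrite !tests_from_rcons //; try exact: ltn_trans pg.
  by split=> //; rewrite !tests_from_rcons.
have ordered p : (p < size g')%N -> ordered_bdd n g' p.
  (* Edges decrease addresses in the extended memory too, which keeps every path inside it. *)
  have down : forall q r, reach g' q r -> (r <= q)%N.
    move=> q r; elim=> // {}r j u v _ rq /branch[[_ ur vr _] _].
      exact: ltnW (leq_trans ur rq).
    exact: ltnW (leq_trans vr rq).
  move=> pg; split=> [q /down qp|q j u v _ gq]; first exact: leq_ltn_trans pg.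
  have [[? _ _ _] [ju jv]] := branch _ _ _ _ gq.
  by split=> // c k t' f' [->|->]; [apply: ju|apply: jv].
have sg : (size g < size g')%N by rewrite size_rcons.
have new p : (p < size g)%N -> ~ same_function g' p (size g).
  move=> pg same; have pg' : (p < size g')%N by apply: ltn_trans sg.
  have same' : same_function g' (size g) p by move=> x b; rewrite (same x b).
  case gp: (onth g p) => [[b|j u v]|].
  - apply: tf; apply: same_old => //.
    apply: same_function_children (ordered _ sg) (ordered _ pg') _ gs same'.
    by move=> j u v; rewrite onth_rcons_lt // gp.
  - case: (ltngtP j i) => [ji|ij|ji].
    + have gp' : onth g' p = Some (Branch j u v) by rewrite onth_rcons_lt.
      have [[_ up vp uv] _] := memory_branch gP gp.
      apply: uv; apply: same_old; try exact: ltn_trans pg.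
      apply: same_function_children (ordered _ pg') (ordered _ sg) _ gp' same.
      by move=> k u' v'; rewrite gs => -[<-].
    + apply: tf; apply: same_old => //.
      apply: same_function_children (ordered _ sg) (ordered _ pg') _ gs same'.
      by move=> k u' v'; rewrite onth_rcons_lt // gp => -[<-].
    + by subst j; apply: fresh gp same.
  - by have [nd] := onth_Some pg; rewrite gp.
split=> // p q; rewrite !size_rcons !ltnS leq_eqVlt => /orP[/eqP->|pg];
  rewrite leq_eqVlt => /orP[/eqP->|qg] same //.
- by case: (new q qg) => x b; rewrite (same x b).
- by case: (new p pg).
- exact: same_old.
Qed.

End Memory.

Lemma shared_memory_terminals n : shared_memory n terminals.
Proof.
have leaf p b : onth terminals p = Some (Leaf b) <-> p = b.
  by case: p b => [|[|[|p]]] [].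
split=> //; first by case=> [|[|[|p]]].
have ev (p : nat) (b : bool) : p = b -> evals terminals (fun=> true) p b.
  by move=> pb; apply/evals_leaf/leaf.
have ev0 := ev 0%N false erefl; have ev1 := ev 1%N true erefl.
move=> [|[|//]] [|[|//]] // _ _ same.
  by have := evals_det ev0 (proj2 (same _ _) ev1).
by have := evals_det ev0 (proj1 (same _ _) ev1).
Qed.

(** * Intervals of integers in closed form *)

Section Intervals.

Implicit Types (I J : interval int) (M N d : int).

Definition closed_itv I : bool :=
  match I with
  | Interval (BSide true _ | BInfty true) (BSide false _ | BInfty false) => true
  | _ => false
  end.

(** Test the inclusion at one point: the lower end of [I] if there is one, which lies in [I] because
    [M] does; otherwise a point of [I] strictly below the lower end of [J], which gives a
    contradiction. *)
Lemma closed_itv_lower I J M : closed_itv I -> closed_itv J -> M \in I ->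
  {subset I <= J} -> (lower J <= lower I)%O.
Proof.
move: I J => [[[] l|[]] [[] u|[]]] [[[] l'|[]] [[] u'|[]]] //= _ _.
all: rewrite in_itv /= => MI IJ; rewrite ?bnd_simp //.
all: first [move: (IJ l) | move: (IJ (Num.min M (l' - 1)))].
all: by rewrite !in_itv /=; lia.
Qed.

Lemma closed_itv_upper I J M : closed_itv I -> closed_itv J -> M \in I ->
  {subset I <= J} -> (upper I <= upper J)%O.
Proof.
move: I J => [[[] l|[]] [[] u|[]]] [[[] l'|[]] [[] u'|[]]] //= _ _.
all: rewrite in_itv /= => MI IJ; rewrite ?bnd_simp //.
all: first [move: (IJ u) | move: (IJ (Num.max M (u' + 1)))].
all: by rewrite !in_itv /=; lia.
Qed.

Lemma closed_itv_inj I J M :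
  closed_itv I -> closed_itv J -> M \in I -> I =i J -> I = J.
Proof.
move=> cI cJ MI IJ; have MJ : M \in J by rewrite -IJ.
have sIJ : {subset I <= J} by move=> N; rewrite IJ.
have sJI : {subset J <= I} by move=> N; rewrite IJ.
have: (lower I = lower J) /\ (upper I = upper J).
  split; apply/le_anti/andP; split.
  - exact: closed_itv_lower cJ cI MJ sJI.
  - exact: closed_itv_lower cI cJ MI sIJ.
  - exact: closed_itv_upper cI cJ MI sIJ.
  - exact: closed_itv_upper cJ cI MJ sJI.
by case: (I) (J) => [? ?] [? ?] /= [-> ->].
Qed.

(** The second disjunct of [same_itv] concerns empty intervals, and here both are inhabited. *)
Lemma same_itv_eq I J M N : M \in I -> N \in J -> same_itv I J -> I = J.
Proof.
move=> MI NJ /orP[/eqP//|/andP[/le_trans le_I _]].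
move: MI; case: I le_I => l u /= le_I; rewrite itv_boundlr => /andP[lM Mu].
by have := le_trans Mu (le_I _ lM); rewrite bnd_simp ltxx.
Qed.

Lemma shift_itv_mem d I M : closed_itv I ->
  (M \in Interval (shift_bound d (lower I)) (shift_bound d (upper I))) =
  (M - d \in I).
Proof.
by case: I => [[[] l|[]] [[] u|[]]] //= _; rewrite !in_itv /=; lia.
Qed.

(** For positive [d] the interval with only its lower end shifted is the intersection of [I] with
    its translate. So the merge case of the algorithm obeys the same rule as the branching case. *)
Lemma shift_lower_mem d I M : closed_itv I -> 0 < d ->
  (M \in Interval (shift_bound d (lower I)) (upper I)) =
  (M \in I) && (M - d \in I).
Proof.
by case: I => [[[] l|[]] [[] u|[]]] //= _; rewrite !in_itv /=; lia.
Qed.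

Lemma closed_shift_lower d I : closed_itv I ->
  closed_itv (Interval (shift_bound d (lower I)) (upper I)).
Proof. by case: I => [[[] l|[]] [[] u|[]]]. Qed.

Lemma closed_shift_itv d I : closed_itv I ->
  closed_itv (Interval (shift_bound d (lower I)) (shift_bound d (upper I))).
Proof. by case: I => [[[] l|[]] [[] u|[]]]. Qed.

Lemma closed_itvI I J : closed_itv I -> closed_itv J -> closed_itv (I `&` J)%O.
Proof.
have -> : (I `&` J)%O = Interval (Order.max (lower I) (lower J))
                                 (Order.min (upper I) (upper J)).
  by case: I J => [l u] [l' u'] /=; rewrite -joinEtotal -meetEtotal.
case: I J => [l u] [l' u'] /=; case: leP => _; case: leP => _.
all: by case: l l' u u' => [[] l|[]] [[] l'|[]] [[] u|[]] [[] u'|[]].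
Qed.

End Intervals.

(** * The functions of the constraints and their cofactors *)

Section PseudoBoolean.

Variable a : seq int.
Implicit Types (i : nat) (M K : int) (x y : assignment).

Lemma pb_agree i M x y :
  (forall j, (i <= j)%N -> x j = y j) -> pb a i M x = pb a i M y.
Proof.
move=> agree; rewrite /pb; congr (_ <= _).
by apply: eq_big_nat => j /andP[ij _]; rewrite agree.
Qed.

Lemma pb_recl i M x : (i < size a)%N ->
  pb a i M x = pb a i.+1 (if x i then M - a`_i else M) x.
Proof.
move=> ia; rewrite /pb big_ltn //.
by case: (x i); rewrite ?mulr1 ?mulr0 ?add0r // lerBrDl.
Qed.

(** The bound left for the remaining variables once the first [i] are fixed by [y]; every recursive
    call has a bound of this form. *)
Definition residual K i y : int := K - \sum_(0 <= j < i) a`_j * (y j)%:R.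

Lemma pb_residual K i x y : (i <= size a)%N ->
  pb a 0 K (fun j => if (j < i)%N then y j else x j) = pb a i (residual K i y) x.
Proof.
move=> ia; rewrite /pb /residual (big_cat_nat _ ia) //= lerBrDl.
congr (_ + _ <= _); apply: eq_big_nat => j /andP[? ?]; first by rewrite ifT.
by rewrite ltnNge ifN // negbK.
Qed.

Hypothesis a_gt0 : forall j, (j < size a)%N -> 0 < a`_j.

Lemma pb_false i M : M \in (`]-oo, (-1)%R] : interval int) <->
  forall x, pb a i M x = false.
Proof.
rewrite in_itv /=; split=> [M0 x|/(_ (fun=> false))].
  apply/negbTE; rewrite -ltNge; apply: (@lt_le_trans _ _ 0); first by lia.
  rewrite big_nat_cond; apply: sumr_ge0 => j /andP[/andP[_ /a_gt0 aj] _].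
  by rewrite mulr_ge0 // ltW.
move/negbT; rewrite /pb big1; last by move=> *; rewrite mulr0.
by rewrite -ltNge; lia.
Qed.

Lemma pb_true i M : M \in `[\sum_(i <= j < size a) a`_j, +oo[ <->
  forall x, pb a i M x = true.
Proof.
rewrite in_itv /= andbT; split=> [MS x|/(_ (fun=> true))].
  apply: le_trans MS; apply: ler_sum_nat => j /andP[_ /a_gt0 aj].
  by case: (x j); rewrite ?mulr1 ?mulr0 // ltW.
by rewrite /pb (eq_bigr (nth 0 a)) // => j _; rewrite /= mulr1.
Qed.

(** Only the evaluation rule of [p] is assumed, not that it is a branch node. This covers both a new
    node and the merge, where [p], [t] and [f] coincide. In the forward direction, forcing variable
    [i] isolates one child, which does not read it. *)
Lemma represents_pb_recl n g p t f i M : (i < size a)%N ->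
  ordered_bdd n g t -> ordered_bdd n g f ->
  tests_from g i.+1 t -> tests_from g i.+1 f ->
  (forall x b, evals g x p b <-> evals g x (if x i then t else f) b) ->
  represents g p (pb a i M) <->
  represents g f (pb a i.+1 M) /\ represents g t (pb a i.+1 (M - a`_i)).
Proof.
move=> ia ordt ordf ti fi pE; split=> [pM|[fM tM] x]; last first.
  by apply/pE; rewrite pb_recl //; case: (x i).
have upd x c : evals g (update x i c) (if c then t else f)
    (pb a i.+1 (if c then M - a`_i else M) x).
  have xi : update x i c i = c by rewrite /update eqxx.
  have /pE := pM (update x i c); rewrite pb_recl // !xi.
  rewrite (@pb_agree _ _ _ x) // => j ij.
  by rewrite /update gtn_eqF.
split=> x; [have := upd x false|have := upd x true] => /=.
  by move/(evals_update _ _ _ ordf fi).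
by move/(evals_update _ _ _ ordt ti).
Qed.

End PseudoBoolean.

(** * The invariant of the algorithm and its preservation *)

Section Invariant.

Variables (S : search_tree) (a : seq int) (K : int).
Hypothesis a_gt0 : forall j, (j < size a)%N -> 0 < a`_j.

Implicit Types (st : state S) (g : graph) (e : entry) (c : call) (i j p : nat).

Record good_entry g i e : Prop := GoodEntry {
  entry_root : (e.2 < size g)%N;
  entry_closed : closed_itv e.1;
  entry_inh : exists M, M \in e.1;
  entry_tests : tests_from g i e.2;
  entry_itv M : M \in e.1 <-> represents g e.2 (pb a i M)
}.

Definition good_call c :=
  [/\ call_bound c \in call_itv c,
      forall M, M \in call_itv c <->
        represents (call_graph c) (call_root c) (pb a (call_index c) M)
    & ROBDD (size a) (call_graph c) (call_root c)].

(** [inv_node] traces every branch node back to an entry of the list of its variable, which is what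
    makes a miss prove a new node fresh. [inv_residual] ties the non-initial entries to cofactors of
    the constraint, for the counting. The last field accumulates the correctness claims of completed
    calls. *)
Record inv st : Prop := Inv {
  inv_memory : shared_memory (size a) (memory st);
  inv_node p i t f : onth (memory st) p = Some (Branch i t f) ->
    exists I, (I, p) \in elems (lists st i);
  inv_entry i e : e \in elems (lists st i) -> good_entry (memory st) i e;
  inv_false i : false_entry \in elems (lists st i);
  inv_true i : true_entry a i \in elems (lists st i);
  inv_residual i e : e \in elems (lists st i) ->
    [\/ e = false_entry, e = true_entry a i
      | exists y, residual a K i y \in e.1];
  inv_calls c : List.In c (calls st) -> good_call c
}.

Lemma good_entry_rcons g nd i e : shared_memory (size a) g ->
  good_entry g i e -> good_entry (rcons g nd) i e.
Proof.
move=> gP [eg cl inh te ei]; split=> //.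
- by rewrite size_rcons ltnW.
- by rewrite tests_from_rcons.
- by move=> M; rewrite (represents_rcons gP _ _ eg).
Qed.

(** A common bound gives both roots the same function, hence the same address; each interval is then
    the full set of bounds of that one function. *)
Lemma entry_overlap st i e e' M : inv st ->
  e \in elems (lists st i) -> e' \in elems (lists st i) ->
  M \in e.1 -> M \in e'.1 -> e = e'.
Proof.
move=> stP el el' Me Me'.
have [eg cl _ _ ei] := inv_entry stP el.
have [eg' cl' _ _ ei'] := inv_entry stP el'.
have ee' : e.2 = e'.2.
  apply: (memory_inj (inv_memory stP)) => //.
  exact: represents_same (proj1 (ei M) Me) (proj1 (ei' M) Me').
have : e.1 = e'.1.
  apply: (closed_itv_inj cl cl' Me) => N; apply/idP/idP.
    by move/ei; rewrite ee' => /ei'.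
  by move/ei'; rewrite -ee' => /ei.
by case: e e' ee' {el el' Me Me' eg eg' cl cl' ei ei'} => [I p] [J q] /= -> ->.
Qed.

Lemma entry_good_call st i e M : inv st ->
  e \in elems (lists st i) -> M \in e.1 ->
  good_call (Call i M e.1 e.2 (memory st)).
Proof.
move=> stP el Me; have [eg _ _ _ ei] := inv_entry stP el.
by split=> //; apply: memory_ROBDD (inv_memory stP) _ eg.
Qed.

Lemma In_rcons (T : Type) (s : seq T) x y :
  List.In x (rcons s y) -> x = y \/ List.In x s.
Proof.
elim: s => /= [[->|//]|z s IH [->|/IH[]]]; first by left.
- by right; left.
- by left.
- by right; right.
Qed.

Lemma inv_return st i e M d : inv st -> e \in elems (lists st i) -> M \in e.1 ->
  inv (State (memory st) (lists st)
         (rcons (calls st) (Call i M e.1 e.2 (memory st))) d).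
Proof.
move=> stP el Me; case: (stP) => *; split=> //= c c_in.
case: (In_rcons c_in) => [->|]; [exact: entry_good_call|exact: inv_calls].
Qed.

Lemma inv_spend st d : inv st -> inv (spend d st).
Proof. by case. Qed.

Definition add_entry i e st g : state S :=
  State g (fun j => if j == i then insert e (lists st i) else lists st j)
    (calls st) (time st).

Lemma elems_add_entry i e st g j e' :
  e' \in elems (lists (add_entry i e st g) j) ->
  (j = i /\ e' = e) \/ e' \in elems (lists st j).
Proof.
rewrite /=; case: eqP => [->|_]; last by right.
rewrite elems_insert inE => /orP[/eqP|]; first by left.
by right.
Qed.

Lemma elems_add_entryW i e st g j e' :
  e' \in elems (lists st j) -> e' \in elems (lists (add_entry i e st g) j).
Proof.
by rewrite /=; case: eqP => [->|//]; rewrite elems_insert inE orbC => ->.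
Qed.

Lemma inv_add_entry st i e g y :
  inv st -> shared_memory (size a) g ->
  (forall p j t f, onth g p = Some (Branch j t f) ->
     onth (memory st) p = Some (Branch j t f) \/ j = i /\ p = e.2) ->
  (forall j e', e' \in elems (lists st j) -> good_entry g j e') ->
  good_entry g i e -> residual a K i y \in e.1 ->
  inv (add_entry i e st g).
Proof.
move=> stP gP nodes old new res; split=> //.
- move=> p j t f /nodes[/(inv_node stP)[I pI]|[-> ->]].
    by exists I; apply: elems_add_entryW.
  by exists e.1; rewrite /= eqxx elems_insert inE -surjective_pairing eqxx.
- by move=> j e' /elems_add_entry[[-> ->]//|/old].
- by move=> j; apply/elems_add_entryW/inv_false.
- by move=> j; apply/elems_add_entryW/inv_true.
- move=> j e' /elems_add_entry[[-> ->]|/(inv_residual stP)//].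
  by constructor 3; exists y.
- exact: inv_calls stP.
Qed.

(** With no variable left the sum is empty, so the two initial entries cover all integers and the
    run-time error cannot occur. *)
Lemma inv_hit st i M : inv st -> (size a <= i)%N ->
  exists2 e, e \in elems (lists st i) & M \in e.1.
Proof.
move=> stP ai; have [M0|M0] := leP 0 M.
  exists (true_entry a i); first exact: inv_true.
  by rewrite /true_entry big_geq // in_itv /= M0.
exists false_entry; first exact: inv_false.
by rewrite in_itv /=; lia.
Qed.

Lemma inv_merge st i y : inv st -> (i < size a)%N ->
  forall eF eT,
  eF \in elems (lists st i.+1) -> residual a K i y \in eF.1 ->
  eT \in elems (lists st i.+1) -> residual a K i y - a`_i \in eT.1 ->
  same_itv eT.1 eF.1 ->
  let e := (Interval (shift_bound a`_i (lower eT.1)) (upper eT.1), eT.2) in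
  residual a K i y \in e.1 /\ inv (add_entry i e st (memory st)).
Proof.
move=> stP ia eF eT elF KF elT KT /(same_itv_eq KT KF) eTF e.
have gP := inv_memory stP; have KT' : residual a K i y \in eT.1 by rewrite eTF.
have [Tg cT _ tT iT] := inv_entry stP elT.
have memE := shift_lower_mem _ cT (a_gt0 ia).
have Ke : residual a K i y \in e.1 by rewrite memE KT' KT.
split=> //; apply: (inv_add_entry _ _ _ _ _ Ke) => //; first by left.
  exact: inv_entry.
split=> //=.
- exact: closed_shift_lower.
- by exists (residual a K i y); exact: Ke.
- exact: tests_fromW tT.
- move=> M; rewrite memE; have ordT := memory_ordered gP Tg.
  rewrite (represents_pb_recl M ia ordT ordT tT tT).
    by rewrite -!iT; apply: iff_sym; apply: (rwP andP).
  by move=> x b; rewrite if_same.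
Qed.

Lemma inv_branch st i y : inv st -> (i < size a)%N ->
  (forall e, e \in elems (lists st i) -> residual a K i y \notin e.1) ->
  forall eF eT,
  eF \in elems (lists st i.+1) -> residual a K i y \in eF.1 ->
  eT \in elems (lists st i.+1) -> residual a K i y - a`_i \in eT.1 ->
  ~~ same_itv eT.1 eF.1 ->
  let IT := Interval (shift_bound a`_i (lower eT.1))
                     (shift_bound a`_i (upper eT.1)) in
  let e := ((eF.1 `&` IT)%O, size (memory st)) in
  residual a K i y \in e.1 /\
  inv (add_entry i e st (rcons (memory st) (Branch i eT.2 eF.2))).
Proof.
move=> stP ia miss eF eT elF KF elT KT neTF IT e.
have gP := inv_memory stP; set g := memory st in gP e *.
have [Tg cT _ tT iT] := inv_entry stP elT.
have [Fg cF _ tF iF] := inv_entry stP elF.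
have memE M : (M \in e.1) = (M \in eF.1) && (M - a`_i \in eT.1).
  by rewrite in_itvI shift_itv_mem.
have Ke : residual a K i y \in e.1 by rewrite memE KF KT.
(* Equal roots would have the same set of bounds, hence equal intervals, against the failed test. *)
have TF : eT.2 <> eF.2.
  move=> eq2; move: neTF; rewrite (_ : eT.1 = eF.1) ?/same_itv ?eqxx //.
  apply: (closed_itv_inj cT cF KT) => N; apply/idP/idP.
    by move/iT; rewrite eq2 => /iF.
  by move/iF; rewrite -eq2 => /iT.
have represE M : represents (rcons g (Branch i eT.2 eF.2)) (size g) (pb a i M) <->
    M \in e.1.
  set g' := rcons g _.
  have gE : forall x b, evals g' x (size g) b <->
      evals g' x (if x i then eT.2 else eF.2) b.
    by move=> x b; apply: evals_branchE; apply: onth_rcons_size.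
  have ord p : (p < size g)%N -> ordered_bdd (size a) g' p.
    exact: ordered_bdd_rcons.
  rewrite (represents_pb_recl M ia (ord _ Tg) (ord _ Fg) _ _ gE);
    rewrite ?tests_from_rcons // !(represents_rcons gP) //.
  by rewrite -iF -iT memE; apply: (rwP andP).
have gP' : shared_memory (size a) (rcons g (Branch i eT.2 eF.2)).
  apply: shared_memory_rcons => // p t f gp same.
  (* An old node for variable [i] with the new function roots an entry whose interval contains the
     searched bound, contradicting [miss]. *)
  have [I /[dup] elI /(inv_entry stP)[pg _ _ _ iI]] := inv_node stP gp.
  have /negP := miss _ elI; apply; apply/iI/(represents_rcons gP _ _ pg).
  by move=> x; apply/same; apply: (proj2 (represE _) Ke).
split=> //; apply: (inv_add_entry _ _ _ _ _ Ke) => //.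
- by move=> p j t f /onth_rcons_inv[[_ gp]|[-> [-> _ _]]]; [left|right].
- by move=> j e' /(inv_entry stP); apply: good_entry_rcons.
split=> //=.
- by rewrite size_rcons.
- by apply: closed_itvI => //; apply: closed_shift_itv.
- by exists (residual a K i y); exact: Ke.
- by move=> j t f; rewrite onth_rcons_size => -[<-].
- by move=> M; apply: iff_sym; apply: represE.
Qed.

(** The pigeonhole principle for a relation: representing a function is not a decidable property, so
    no map from entries to nodes is at hand. *)
Lemma leq_size_rel (T U : eqType) (P : T -> U -> Prop) (s : seq T) (t : seq U) :
  uniq s -> (forall x, x \in s -> exists2 y, y \in t & P x y) ->
  (forall x x' y, x \in s -> x' \in s -> P x y -> P x' y -> x = x') ->
  (size s <= size t)%N.
Proof.
elim: s t => //= x s IH t /andP[xs us] ex inj.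
have [y yt Pxy] := ex x (mem_head _ _).
suff : (size s <= size (rem y t))%N.
  by rewrite size_rem //; case: (t) yt => // z t' _ /=; rewrite ltnS.
apply: IH us _ _ => [x' x's|x1 x2 z x1s x2s]; last first.
  by apply: inj; rewrite inE ?x1s ?x2s orbT.
have x'xs : x' \in x :: s by rewrite inE x's orbT.
have [y' y't Px'y'] := ex x' x'xs; exists y' => //.
apply: rem_mem y't; apply/eqP=> yy'; move: xs; rewrite yy' in Px'y'.
by rewrite (inj _ _ _ (mem_head _ _) x'xs Pxy Px'y') x's.
Qed.

(* Distinct entries of [L_i] other than the two initial ones contain distinct
   cofactors of the constraint, hence correspond to distinct ROBDD nodes. *)
Lemma inv_size st i m : inv st -> (i <= size a)%N -> robdd_size a K m ->
  (size (elems (lists st i)) <= m.+2)%N.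
Proof.
move=> stP ia [g [r [[ord _] rK [s [us <- sE]]]]].
set es := elems _; pose ini := [:: false_entry; true_entry a i].
pose es' := [seq e <- es | e \notin ini].
suff le_s : (size es' <= size s)%N.
  have : (size es <= size (ini ++ es'))%N.
    apply: uniq_leq_size (elems_uniq _) _ => e el.
    by rewrite mem_cat mem_filter el andbT orbN.
  by rewrite size_cat /= => /leq_trans; apply; rewrite !ltnS.
pose P (e : entry) p := exists2 M, M \in e.1 & represents g p (pb a i M).
apply: (@leq_size_rel _ _ P); first exact/filter_uniq/elems_uniq.
  move=> e; rewrite mem_filter !inE negb_or => /andP[/andP[/eqP nf /eqP nt] el].
  have [//|//|[y ey]] := inv_residual stP el.
  have [p [rp _ pF]] := cofactor_node y i
    (fun x x' xx' => pb_agree a K (i := 0) (fun j _ => xx' j)) ord rK.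
  exists p; first exact/sE.
  exists (residual a K i y) => //; apply: represents_eq pF => x.
  exact: pb_residual.
move=> e e' p; rewrite !mem_filter => /andP[_ el] /andP[_ el'].
move=> [M Me pM] [M' Me' pM'].
(* The shared node [p] makes the functions for [M] and [M'] equal, so [M'] lies in both
   intervals. *)
apply: (entry_overlap stP el el' _ Me'); apply/(entry_itv (inv_entry stP el)).
apply: represents_eq (represents_inj pM pM') _.
exact/(entry_itv (inv_entry stP el)).
Qed.

(** * Amortized running time *)

Definition total st : nat := (\sum_(j < size a) size (elems (lists st j)))%N.

Lemma size_insert (e : entry) (t : tree S) : e \notin elems t ->
  size (elems (insert e t)) = (size (elems t)).+1.
Proof.
move=> et; have : perm_eq (elems (insert e t)) (e :: elems t).
  apply: uniq_perm; rewrite /= ?et ?elems_uniq //; exact: elems_insert.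
by move/perm_size.
Qed.

Lemma total_add_entry i e st g : (i < size a)%N -> e \notin elems (lists st i) ->
  total (add_entry i e st g) = (total st).+1.
Proof.
move=> ia ei; rewrite /total (bigD1 (Ordinal ia)) //= eqxx size_insert //.
rewrite addSn [in RHS](bigD1 (Ordinal ia)) //=; congr (_ + _).+1.
by apply: eq_bigr => j; rewrite -val_eqE /= => /negbTE->.
Qed.

Lemma residualS i y b :
  residual a K i.+1 (update y i b) = residual a K i y - a`_i * b%:R.
Proof.
rewrite /residual big_nat_recr //= {2}/update eqxx opprD addrA.
congr (_ - _ - _); apply: eq_big_nat => j /andP[_ ji].
by rewrite /update ltn_eqF.
Qed.

Variable c0 : nat.

(** Quantifying over all states that satisfy the invariant lets one [N] serve the whole recursion,
    and keeps the ROBDD out of the correctness proof. *)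
Definition bounded_lists N := forall st, inv st ->
  forall j, (j <= size a)%N -> (size (elems (lists st j)) <= N)%N.

Definition step_cost N := (c0 + log_factor S * (trunc_log 2 N).+1)%N.

Lemma search_cost N st k j : bounded_lists N -> inv st -> (j <= size a)%N ->
  (c0 + search_time k (lists st j) <= step_cost N)%N.
Proof.
move=> bN stP ja; rewrite leq_add2l; apply: leq_trans (search_time_log _ _) _.
by rewrite leq_mul2l ltnS leq_trunc_log ?orbT // bN.
Qed.

Lemma insert_cost N st e j : bounded_lists N -> inv st -> (j <= size a)%N ->
  (c0 + insert_time e (lists st j) <= step_cost N)%N.
Proof.
move=> bN stP ja; rewrite leq_add2l; apply: leq_trans (insert_time_log _ _) _.
by rewrite leq_mul2l ltnS leq_trunc_log ?orbT // bN.
Qed.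

Lemma total_le N st : bounded_lists N -> inv st -> (total st <= size a * N)%N.
Proof.
move=> bN stP; rewrite -[X in (X * _)%N](card_ord (size a)) -sum_nat_const.
by apply: leq_sum => j _; apply: bN => //; apply: ltnW.
Qed.

(* Amortized cost: a miss costs at most two steps besides its two calls, each
   of which is charged one step, and it adds one entry. *)
Definition amortized st st' := forall N, bounded_lists N ->
  (time st' + 3 * step_cost N * total st <=
   time st + step_cost N + 3 * step_cost N * total st')%N.

(** [outcome_below] makes a miss in a list survive the two recursive calls, which act on later lists
    only; [outcome_sub] keeps the entry of the first call available after the second. *)
Record outcome i K' st e st' : Prop := Outcome {
  outcome_inv : inv st';
  outcome_mem : e \in elems (lists st' i);
  outcome_itv : K' \in e.1;
  outcome_below j : (j < i)%N -> lists st' j = lists st j;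
  outcome_sub j e' : e' \in elems (lists st j) -> e' \in elems (lists st' j);
  outcome_time : amortized st st'
}.

Lemma outcome_hit i K' st e d : inv st -> (i <= size a)%N ->
  e \in elems (lists st i) -> K' \in e.1 ->
  (forall N, bounded_lists N -> (d <= step_cost N)%N) ->
  exists st', return_from i K' e (spend d st) = Some (e, st') /\
    outcome i K' st e st'.
Proof.
move=> stP ia el Ke dN; eexists; split; first by [].
split=> //; first exact: inv_return (inv_spend d stP) el Ke.
by move=> N /dN; rewrite /total /=; lia.
Qed.

Lemma outcome_miss i K' st0 d0 st1 st2 eF eT e g d2 :
  inv st0 -> (i < size a)%N ->
  (forall e, e \in elems (lists st0 i) -> K' \notin e.1) ->
  outcome i.+1 K' (spend d0 st0) eF st1 ->
  outcome i.+1 (K' - a`_i) st1 eT st2 ->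
  K' \in e.1 -> inv (add_entry i e st2 g) ->
  (forall N, bounded_lists N -> (d0 <= step_cost N)%N) ->
  (forall N, bounded_lists N -> (d2 <= step_cost N)%N) ->
  let st3 := add_entry i e st2 g in
  outcome i K' st0 e (State (memory st3) (lists st3)
    (rcons (calls st3) (Call i K' e.1 e.2 (memory st3))) (time st2 + d2)).
Proof.
move=> stP ia miss oF oT Ke st3P d0N d2N st3.
have el : e \in elems (lists st3 i) by rewrite /= eqxx elems_insert mem_head.
have same j : (j <= i)%N -> lists st2 j = lists st0 j.
  by move=> ji; rewrite (outcome_below oT) // (outcome_below oF).
split=> //.
- exact: inv_return.
- by move=> j ji; rewrite /= ltn_eqF // same // ltnW.
- move=> j e' e'l; apply: elems_add_entryW.
  by apply: (outcome_sub oT); apply: (outcome_sub oF).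
(* With [W] for [step_cost N]: the two phases cost at most [2 * W], the two calls are charged
   [2 * W], and the new entry pays [3 * W], leaving the charge [W] of this call. *)
move=> N bN; have := outcome_time oF bN; have := outcome_time oT bN.
have := d0N N bN; have := d2N N bN.
have eN : e \notin elems (lists st2 i).
  by rewrite same //; apply/negP => /miss; rewrite Ke.
have tot := total_add_entry g ia eN; rewrite /= [total (State _ _ _ _)]tot.
by rewrite [total (spend _ _)]/total -/(total st0); lia.
Qed.

Lemma BDDConstruction_spec s i K' y st :
  inv st -> (i <= size a)%N -> s = drop i a -> K' = residual a K i y ->
  exists e st',
    BDDConstruction c0 i s K' st = Some (e, st') /\ outcome i K' st e st'.
Proof.
elim: s i K' y st => [|ai s IH] i K' y st stP ia si KE.
  have ai : (size a <= i)%N.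
    by move: (size_drop i a); rewrite -si /= => /esym/eqP; rewrite subn_eq0.
  have [e el eK] := inv_hit K' stP ai.
  rewrite /=; have := searchP K' (lists st i).
  case: search => [e' [e'l e'K]|/(_ e el)]; last by rewrite eK.
  exists e'; apply: outcome_hit => // N bN; exact: search_cost.
rewrite /=; have := searchP K' (lists st i).
case: search => [e [el eK]|miss].
  exists e; apply: outcome_hit => // N bN; exact: search_cost.
have {}ia : (i < size a)%N.
  by move: (size_drop i a); rewrite -si /= => /eqP; lia.
have [aiE sE] : ai = a`_i /\ s = drop i.+1 a.
  by move: si; rewrite (drop_nth 0 ia) => -[].
set d0 := (c0 + _)%N.
have KF : K' = residual a K i.+1 (update y i false).
  by rewrite residualS mulr0 subr0.
have [eF [st1 [-> oF]]] := IH _ _ _ _ (inv_spend d0 stP) ia sE KF.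
have KT : K' - a`_i = residual a K i.+1 (update y i true).
  by rewrite residualS mulr1 -KE.
rewrite aiE; have [eT [st2 [-> oT]]] := IH _ _ _ _ (outcome_inv oF) ia sE KT.
case: eF oF => IF BF oF; case: eT oT => IT BT oT.
have st2P := outcome_inv oT.
have elF := outcome_sub oT (outcome_mem oF).
have miss2 e : e \in elems (lists st2 i) -> residual a K i y \notin e.1.
  by rewrite (outcome_below oT) // (outcome_below oF) // -KE; apply: miss.
have d0N N : bounded_lists N -> (d0 <= step_cost N)%N.
  by move=> bN; apply: search_cost (ltnW ia).
have d2N e N : bounded_lists N ->
    (c0 + insert_time e (lists st2 i) <= step_cost N)%N.
  by move=> bN; apply: insert_cost (ltnW ia).
have KIF := outcome_itv oF; have KIT := outcome_itv oT.
rewrite KE in KIF KIT.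
case: ifPn => [same|nsame] /=.
  have [Ke eP] := inv_merge st2P ia elF KIF (outcome_mem oT) KIT same.
  eexists; eexists; split; first by [].
  rewrite -KE in Ke; rewrite /= -addnA.
  exact: (outcome_miss stP ia miss oF oT Ke eP d0N (d2N _)).
have [Ke eP] := inv_branch st2P ia miss2 elF KIF (outcome_mem oT) KIT nsame.
eexists; eexists; split; first by [].
rewrite -KE in Ke; rewrite /= -addnA.
exact: (outcome_miss stP ia miss oF oT Ke eP d0N (d2N _)).
Qed.

End Invariant.

(** * The initial state *)

Section Initial.

Variables (S : search_tree) (a : seq int).

Lemma elems_initial_list i :
  elems (initial_list S a i) =i [:: true_entry a i; false_entry].
Proof. by move=> e; rewrite elems_insert inE elems_insert elems_empty. Qed.

Lemma size_initial_list i : size (elems (initial_list S a i)) = 2.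
Proof. by rewrite !size_insert ?elems_insert elems_empty. Qed.

Lemma total_initial t :
  total a (State terminals (initial_list S a) [::] t) = (2 * size a)%N.
Proof.
rewrite /total /= (eq_bigr (fun=> 2%N)) => [|j _]; last exact: size_initial_list.
by rewrite sum_nat_const card_ord mulnC.
Qed.

Lemma initial_time_le c0 :
  (initial_time S c0 a <= (size a).+1 * (c0 + 2 * log_factor S))%N.
Proof.
rewrite -[X in (X * _)%N](card_ord (size a).+1) -sum_nat_const; apply: leq_sum => i _.
have := insert_time_log false_entry (empty S); rewrite elems_empty.
have := insert_time_log (true_entry a i) (insert false_entry (empty S)).
by rewrite size_insert elems_empty // trunc_log1 trunc_log0; lia.
Qed.

Hypothesis a_gt0 : forall j, (j < size a)%N -> 0 < a`_j.

Lemma inv_initial K t : inv a K (State terminals (initial_list S a) [::] t).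
Proof.
have gP := shared_memory_terminals (size a).
have leafE p (b : bool) F : p = b :> nat ->
    (forall x, F x = b) <-> represents terminals p F.
  move=> pb; have gp := proj2 (memory_leaf gP p b) pb.
  split=> pF x; first by apply/(evals_leafE _ _ gp).
  exact/(evals_leafE _ _ gp).
have tests p i : tests_from terminals i p.
  by case: p => [|[|[|p]]].
split=> //=.
- by move=> [|[|[|p]]].
- move=> i e; rewrite elems_initial_list !inE => /orP[]/eqP->; split=> //=.
  + by exists (\sum_(i <= j < size a) a`_j); rewrite in_itv /= lexx.
  + move=> M; apply: iff_trans (pb_true a_gt0 i M) _.
    exact: (leafE _ true).
  + by exists (-1).
  + move=> M; apply: iff_trans (pb_false a_gt0 i M) _.
    exact: (leafE _ false).
- by move=> i; rewrite elems_initial_list !inE eqxx orbT.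
- by move=> i; rewrite elems_initial_list !inE eqxx.
move=> i e; rewrite elems_initial_list !inE.
by move=> /orP[]/eqP->; [constructor 2|constructor 1].
Qed.

End Initial.

(** * The numerical bound and the theorem *)

Lemma robdd_size0 K m : robdd_size [::] K m -> (m <= 1)%N.
Proof.
move=> [g [r [[[_ ord] _] _ [s [us <- sE]]]]].
have : forall p, reach g r p -> p = r.
  by move=> p; elim=> // {}p i t f rp _ gp; have [] := ord _ _ _ _ rp gp.
move=> only_r; apply: (@uniq_leq_size _ s [:: r]) => // p /sE /only_r ->.
exact: mem_head.
Qed.

(** From [m >= 2], [m + 2] is at most [2 * m], so its logarithm exceeds that of [m] by at most one;
    the additive constants are absorbed because the logarithm of [m] is at least one. *)
Lemma step_cost_log S c0 m : (2 <= m)%N ->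
  (step_cost S c0 m.+2 <= (c0 + 3 * log_factor S) * trunc_log 2 m)%N.
Proof.
move=> m2; have log_m : (0 < trunc_log 2 m)%N by rewrite trunc_log_gt0.
have : (trunc_log 2 m.+2 <= (trunc_log 2 m).+1)%N.
  rewrite -trunc_logMp // ?(ltnW m2) //; apply: leq_trunc_log; lia.
by rewrite /step_cost; nia.
Qed.

Lemma time_arith n m l D W T t u :
  (0 < n)%N -> (2 <= m)%N -> (0 < l)%N ->
  (W <= D * l)%N -> (u <= n.+1 * D)%N -> (T <= n * m.+2)%N ->
  (t + 3 * W * (2 * n) <= u + W + 3 * W * T)%N ->
  (t <= 5 * D * (n * m * l))%N.
Proof.
move=> n0 m2 l0 WD uD Tnm tT.
have nm : (n.+1 <= n * m)%N by nia.
have t_le : (t <= u + W * (4 * (n * m)))%N.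
  have := leq_mul (leqnn (3 * W)) Tnm.
  have : (W <= W * (n * m))%N by rewrite leq_pmulr //; lia.
  (* The two initial entries in each of the [n] lists cancel the [+ 2] in the bound on their
     sizes. *)
  by rewrite (_ : 3 * W * (n * m.+2) = 3 * (W * (n * m)) + 3 * W * (2 * n))%N; lia.
have u_le : (u <= D * l * (n * m))%N.
  apply: leq_trans uD _; rewrite mulnC; apply: leq_mul => //.
  by rewrite leq_pmulr.
have := leq_mul WD (leqnn (4 * (n * m))); lia.
Qed.

Theorem theorem19 (S : search_tree) (c0 : nat) :
  exists C : nat,
  forall (n : nat) (a : n.-tuple int) (K : int),
    (forall j : 'I_n, 0 < tnth a j) -> 0 < K ->
    exists (B : nat) (st : state S),
      Main S c0 a K = Some (B, st) /\
      [/\ forall m : nat, robdd_size a K m -> (2 <= m)%N ->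
            (time st <= C * (n * m * trunc_log 2 m))%N,
          forall c : call, List.In c (calls st) ->
            call_bound c \in call_itv c,
          forall c : call, List.In c (calls st) ->
            forall M : int,
              M \in call_itv c <->
              represents (call_graph c) (call_root c) (pb a (call_index c) M)
        & forall c : call, List.In c (calls st) ->
            ROBDD n (call_graph c) (call_root c)].
Proof.
(* Of the factor 5, one part pays for the initialisation, three for the inserted entries and one for
   the outermost call. *)
exists (5 * (c0 + 3 * log_factor S))%N => n a K a_gt0 _.
have {}a_gt0 j : (j < size a)%N -> 0 < a`_j.
  rewrite size_tuple => jn.
  by have := a_gt0 (Ordinal jn); rewrite (tnth_nth 0).
have st0P := inv_initial S a_gt0 K (initial_time S c0 a).
have K0 : K = residual a K 0 (fun=> false).
  by rewrite /residual big_geq // subr0.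
have [[I B] [st [mainE out]]] :=
  BDDConstruction_spec a_gt0 c0 st0P (leq0n _) (esym (drop0 a)) K0.
have stP := outcome_inv out; exists B, st.
split; first by rewrite /Main mainE.
have callP c : List.In c (calls st) -> good_call a c by move/(inv_calls stP).
split=> [m mP m2|c /callP[]//|c /callP[]//|c /callP[_ _]]; last first.
  by rewrite size_tuple.
(* For [n = 0] the claimed bound would be 0; this case is excluded because the ROBDD is then a
   single leaf, against [m >= 2]. *)
have n_gt0 : (0 < n)%N.
  case: n a {a_gt0 st0P K0 mainE out stP callP} mP => // a mP.
  by move: mP m2; rewrite (tuple0 a) => /robdd_size0; lia.
have bN : bounded_lists S a K m.+2.
  by move=> st' st'P j ja; apply: inv_size mP.
have := outcome_time out bN.
have := total_le bN stP; rewrite total_initial size_tuple /=.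
apply: time_arith (step_cost_log S c0 m2) _ => //; first by rewrite trunc_log_gt0.
by apply: leq_trans (initial_time_le S a c0) _; rewrite size_tuple; lia.
Qed.
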